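(* Let $\alpha,\beta>-\frac12$, let $N\ge1$, and let $-1=x_0<x_1<\dots<x_N=1$. Let $H_N\in\mathbb{R}^{N\times N}$ be the weighted histopolation matrix with respect to the basis $P^{(\alpha,\beta)}_{j-1}$, $j=1,\dots,N$, let $\widetilde G\in\mathbb{R}^{N\times N}$ be the Gram matrix and $\|\cdot\|_h$ the mesh-weighted discrete norm (all defined in the context). Then for any $\boldsymbol c\in\mathbb{R}^N$, $$\|H_N\boldsymbol c\|_h^2\le\|\boldsymbol c\|_2^2\,\lambda_{\max}(\widetilde G),$$ where $\lambda_{\max}(\widetilde G)$ denotes the maximum eigenvalue of $\widetilde G$. In particular, $$\|H_N\boldsymbol c\|_h\le\|\boldsymbol c\|_2\sqrt{\lambda_{\max}(\widetilde G)} .$$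
   Context: For $\alpha,\beta>-1$, $\omega_{\alpha,\beta}(t)=(1-t)^\alpha(1+t)^\beta$ on $[-1,1]$, and $P_j^{(\alpha,\beta)}$ is the Jacobi polynomial of degree $j$, orthogonal on $[-1,1]$ with respect to $\omega_{\alpha,\beta}$, with the standard normalization $P_j^{(\alpha,\beta)}(1)=\frac{\Gamma(j+\alpha+1)}{\Gamma(j+1)\Gamma(\alpha+1)}$. Put $s_i=[x_{i-1},x_i]$, $h_i=x_i-x_{i-1}$, $i=1,\dots,N$. $[H_N]_{i,j}=\frac1{h_i}\int_{s_i}P^{(\alpha,\beta)}_{j-1}(x)\,\omega_{\alpha,\beta}(x)\,dx$, $i,j=1,\dots,N$. $\|\boldsymbol v\|_h^2=\sum_{i=1}^Nh_i|v_i|^2$ for $\boldsymbol v\in\mathbb{R}^N$. $[\widetilde G]_{\ell,k}=\int_{-1}^1P^{(\alpha,\beta)}_{\ell-1}(x)\,P^{(\alpha,\beta)}_{k-1}(x)\,(\omega_{\alpha,\beta}(x))^2\,dx$, $\ell,k=1,\dots,N$ (finite since $\alpha,\beta>-\frac12$; $\widetilde G$ is symmetric positive definite). *)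

(* Defs.v *)
From HB Require Import structures.
From mathcomp Require Import all_boot all_order all_algebra.
From mathcomp Require Import all_classical all_reals all_analysis.

Set Implicit Arguments.
Unset Strict Implicit.
Unset Printing Implicit Defensive.

Import Order.TTheory GRing.Theory Num.Theory.
Import numFieldNormedType.Exports.

Local Open Scope classical_set_scope.
Local Open Scope ring_scope.

Section Histopolation.
Context {R : realType}.
Local Notation mu := (@lebesgue_measure R).

Definition Gamma (s : R) : R :=
  \int[mu]_(t in `]0, +oo[) (t `^ (s - 1) * expR (- t)).

(* [powR] takes finite values at the endpoints t = 1 and t = -1 even when an
   exponent is negative; this is invisible to the integrals below. *)
Definition jacobi_weight (a b t : R) : R := (1 - t) `^ a * (1 + t) `^ b.

(* For a, b > -1 these conditions determine the sequence P uniquely. *)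
Definition jacobi_polynomials (a b : R) (P : nat -> {poly R}) : Prop :=
  [/\ forall j, size (P j) = j.+1,
      forall i j, i != j ->
        \int[mu]_(t in `[-1, 1]) ((P i).[t] * (P j).[t] * jacobi_weight a b t)
        = 0
    & forall j, (P j).[1] =
        Gamma (j%:R + a + 1) / (Gamma (j%:R + 1) * Gamma (a + 1))].

(* Indices start at 0: the i-th cell is [x i, x i.+1], and column j
   corresponds to the polynomial of degree j. *)
Definition cell_length (x : nat -> R) (i : nat) : R := x i.+1 - x i.

Definition histopolation_mx (a b : R) (P : nat -> {poly R}) (x : nat -> R)
    (N : nat) : 'M[R]_N :=
  \matrix_(i < N, j < N)
    ((cell_length x i)^-1 *
     \int[mu]_(t in `[x i, x i.+1]) ((P j).[t] * jacobi_weight a b t)).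

Definition gram_mx (a b : R) (P : nat -> {poly R}) (N : nat) : 'M[R]_N :=
  \matrix_(l < N, k < N)
    \int[mu]_(t in `[-1, 1])
      ((P l).[t] * (P k).[t] * jacobi_weight a b t ^+ 2).

Definition mesh_norm (x : nat -> R) (N : nat) (v : 'cV[R]_N) : R :=
  Num.sqrt (\sum_(i < N) cell_length x i * `|v i 0| ^+ 2).

Definition norm2 (N : nat) (v : 'cV[R]_N) : R :=
  Num.sqrt (\sum_(i < N) `|v i 0| ^+ 2).

(* The set of eigenvalues is finite, and nonempty when A is symmetric and
   N > 0; the supremum is then a maximum. *)
Definition lambda_max (N : nat) (A : 'M[R]_N) : R :=
  sup [set l : R | eigenvalue A l].

End Histopolation.

(* Main.v *)
Require Import Defs.
From mathcomp Require Import all_boot all_order all_algebra.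
From mathcomp Require Import all_classical all_reals all_analysis.
From mathcomp Require Import measurable_realfun.
From mathcomp Require Import ring lra.

(** Write [f = p * w], where [p] is the polynomial with coefficient vector [c]
    in the basis [P] and [w] is the Jacobi weight. The [i]-th entry of [H_N c] is
    the mean of [f] over the [i]-th cell, so Cauchy-Schwarz on that cell
    ([sqr_Rintegral_le]) gives [h_i |(H_N c)_i|^2 <= \int_{s_i} f^2]. The cells tile
    [[-1, 1]], so summing bounds the squared mesh norm by [\int_{-1}^1 f^2], which
    expands to the quadratic form [c^T G c] of the Gram matrix
    ([mesh_sqr_le_gram]).

    It remains to bound a symmetric real quadratic form by its largest
    eigenvalue ([rayleigh_le_lambda_max]). The Rayleigh quotient attains its
    maximum [l] on the compact unit sphere, at some [v]; then [l - G] is positive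
    semidefinite and vanishes on [v] as a form, which forces [v (l - G) = 0], so
    that [l] is an eigenvalue of [G].

    The analytic point is that every integral above converges. This reduces to
    the integrability of [w^2], whose endpoint exponents [2a] and [2b] exceed [-1]
    ([integrable_jacobi_weight_sqr]). *)

Set Implicit Arguments.
Unset Strict Implicit.
Unset Printing Implicit Defensive.

Import Order.TTheory GRing.Theory Num.Theory.
Import numFieldNormedType.Exports.

Local Open Scope classical_set_scope.
Local Open Scope ring_scope.

(** * The Rayleigh bound for symmetric real matrices *)

Section Rayleigh.
Context {R : realType} (n : nat).
Implicit Types (A : 'M[R]_n) (v w : 'rV[R]_n).

Definition mxform A v w : R := (v *m A *m w^T) 0 0.
Definition sqnorm v : R := \sum_i v 0 i ^+ 2.

Lemma mxform1 v : mxform 1%:M v v = sqnorm v.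
Proof.
by rewrite /mxform mulmx1 mxE; apply: eq_bigr => i _; rewrite mxE expr2.
Qed.

Lemma mxformE A v w : mxform A v w = \sum_i \sum_j v 0 i * w 0 j * A i j.
Proof.
rewrite /mxform mxE exchange_big; apply: eq_bigr => j _.
rewrite !mxE mulr_suml; apply: eq_bigr => i _; ring.
Qed.

Lemma mxformC A v w : A^T = A -> mxform A v w = mxform A w v.
Proof.
move=> sA; rewrite !mxformE exchange_big; apply: eq_bigr => i _.
by apply: eq_bigr => j _; rewrite -[in LHS]sA mxE; ring.
Qed.

Lemma mxformDZl A t u v w :
  mxform A (u + t *: v) w = mxform A u w + t * mxform A v w.
Proof. by rewrite /mxform !mulmxDl -!scalemxAl !mxE. Qed.

Lemma mxformDZr A t u v w :
  mxform A u (v + t *: w) = mxform A u v + t * mxform A u w.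
Proof. by rewrite /mxform linearD linearZ /= mulmxDr -scalemxAr !mxE. Qed.

Lemma mxformZ A k v : mxform A (k *: v) (k *: v) = k ^+ 2 * mxform A v v.
Proof.
have m0l w : mxform A 0 w = 0 by rewrite /mxform !mul0mx mxE.
have m0r w : mxform A w 0 = 0 by rewrite /mxform trmx0 mulmx0 mxE.
by rewrite -[k *: v]add0r mxformDZl !mxformDZr !m0l !m0r; ring.
Qed.

Lemma sqnorm_ge0 v : 0 <= sqnorm v.
Proof. by apply: sumr_ge0 => i _; exact: sqr_ge0. Qed.

Lemma sqnorm_eq0 v : (sqnorm v == 0) = (v == 0).
Proof.
apply/eqP/eqP => [v0|->]; last first.
  by rewrite /sqnorm big1// => i _; rewrite mxE expr0n.
apply/rowP => i; rewrite mxE; apply/eqP.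
by rewrite -sqrf_eq0; apply/eqP/(psumr_eq0P _ v0) => // j _; exact: sqr_ge0.
Qed.

(** First-order optimality: [v] minimizes the nonnegative form [A], so along each
    line [v + t w] the quadratic [2 t A(v, w) + t^2 A(w, w)] is nonnegative for
    all [t], which is possible only if its linear coefficient vanishes. *)
Lemma psd_isotropic_ker A v : A^T = A -> (forall w, 0 <= mxform A w w) ->
  mxform A v v = 0 -> v *m A = 0.
Proof.
move=> sA psdA Av0.
have Avw w : mxform A v w = 0.
  set be := mxform A v w; set ga := mxform A w w.
  have ga0 : 0 <= ga by exact: psdA.
  have quad t : 0 <= 2 * t * be + t ^+ 2 * ga.
    suff <- : mxform A (v + t *: w) (v + t *: w) = 2 * t * be + t ^+ 2 * ga.
      exact: psdA.
    rewrite mxformDZl !mxformDZr Av0 (mxformC w v sA) /be /ga; ring.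
  (* The minimizer would be [t = - be / ga]; adding 1 to the denominator avoids
     the case [ga = 0] and still makes the value negative unless [be = 0]. *)
  have := quad (- be / (ga + 1)).
  have g1 : ga + 1 != 0 by rewrite gt_eqF// ltr_wpDl.
  have -> : 2 * (- be / (ga + 1)) * be + (- be / (ga + 1)) ^+ 2 * ga
      = - (be ^+ 2 * ((ga + 2) / (ga + 1) ^+ 2)) by field.
  have gpos : 0 < (ga + 2) / (ga + 1) ^+ 2.
    by rewrite divr_gt0 ?exprn_gt0// ltr_wpDl.
  rewrite oppr_ge0 pmulr_lle0// => be0.
  by apply/eqP; rewrite -sqrf_eq0 eq_le be0 sqr_ge0.
apply/eqP; rewrite -sqnorm_eq0 -mxform1.
(* Testing against [w = v A] turns [A(v, w) = 0] into [|v A|^2 = 0]. *)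
have := Avw (v *m A); rewrite /mxform mulmx1 => ->; exact: eqxx.
Qed.

Lemma mxform_continuous A : continuous (fun v => mxform A v v).
Proof.
have -> : (fun v => mxform A v v)
    = (fun v => \sum_i \sum_j v 0 i * v 0 j * A i j).
  by apply/funext => v; rewrite mxformE.
have cvg_add : continuous (fun z : R * R => z.1 + z.2) by exact: add_continuous.
move=> v; apply: (cvg_big cvg_add) => [|i _]; first exact: nbhs_filter.
apply: (cvg_big cvg_add) => [|j _]; first exact: nbhs_filter.
have ci k : {for v, continuous (fun u : 'rV[R]_n => u 0 k)} by exact: coord_continuous.
apply: (@cvgM _ _ _ (nbhs_filter v)); last exact: cvg_cst.
exact: (cvgM (ci i) (ci j)).
Qed.

Lemma compact_sphere : compact [set v | sqnorm v = 1].
Proof.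
have sphC : closed [set v | sqnorm v = 1].
  have -> : [set v | sqnorm v = 1] = (fun v => mxform 1%:M v v) @^-1` [set 1].
    by apply/seteqP; split => v /=; rewrite mxform1.
  apply: closed_comp => [v _|]; [exact: mxform_continuous|exact: closed_eq].
have cubeC : compact [set v : 'rV[R]_n | forall i, v ord0 i \in `[(-1), 1]].
  by apply: (@rV_compact _ _ (fun=> `[(-1 : R), 1]%classic)) => _; exact: segment_compact.
apply: (subclosed_compact sphC cubeC) => v /= v1 i.
rewrite in_itv/= -ler_norml -(@expr_le1 _ 2)//.
rewrite real_normK ?num_real// -v1 /sqnorm (bigD1 i)//= lerDl.
by apply: sumr_ge0 => j _; exact: sqr_ge0.
Qed.

(** The maximum over the unit sphere exists by compactness, and homogeneity of
    degree two extends the bound to all vectors. *)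
Lemma rayleigh_max A : (0 < n)%N ->
  exists2 v, sqnorm v = 1 & forall w, mxform A w w <= mxform A v v * sqnorm w.
Proof.
move=> n0.
have sph0 : [set v | sqnorm v = 1] !=set0.
  exists (delta_mx 0 (Ordinal n0)) => /=.
  rewrite /sqnorm (bigD1 (Ordinal n0))//= big1 ?addr0 => [|i iN].
    by rewrite mxE !eqxx expr1n.
  by rewrite mxE (negbTE iN) andbF expr0n.
have [v] := EVT_max_rV sph0 compact_sphere
  (continuous_subspaceT (@mxform_continuous A)).
rewrite inE => /= v1 vmax; exists v => // w.
have [/eqP w0|w0] := boolP (sqnorm w == 0).
  have := w0 => /eqP; rewrite sqnorm_eq0 => /eqP ->.
  by rewrite /mxform !mul0mx mxE (eqP (etrans (sqnorm_eq0 0) (eqxx 0))) mulr0.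
have wpos : 0 < sqnorm w by rewrite lt_def w0 sqnorm_ge0.
set k := (Num.sqrt (sqnorm w))^-1.
have k2 : k ^+ 2 = (sqnorm w)^-1 by rewrite /k exprVn sqr_sqrtr// ltW.
have := vmax (k *: w); rewrite inE /= -{1}mxform1 !mxformZ k2 mxform1.
rewrite mulVf// => /(_ erefl).
by rewrite mulrC ler_pdivrMr.
Qed.

Lemma eigenvalue_form A l : eigenvalue A l ->
  exists2 w, w != 0 & mxform A w w = l * sqnorm w.
Proof.
move=> /eigenvalueP[w wA w0]; exists w => //.
by rewrite -mxform1 /mxform wA -scalemxAl mxE mulmx1.
Qed.

(** The maximum [l] of the Rayleigh quotient bounds every eigenvalue and is one
    itself, so the supremum defining [lambda_max] is over a bounded set that
    contains [l]. *)
Lemma rayleigh_le_lambda_max A : (0 < n)%N -> A^T = A ->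
  forall w, mxform A w w <= lambda_max A * sqnorm w.
Proof.
move=> n0 sA w.
have [v v1 vmax] := rayleigh_max A n0; set l := mxform A v v in vmax.
have formB u : mxform (l%:M - A) u u = l * sqnorm u - mxform A u u.
  by rewrite -mxform1 /mxform mulmxBr mulmxBl mul_mx_scalar -scalemxAl mulmx1 !mxE.
have : v *m (l%:M - A) = 0.
  apply: psd_isotropic_ker.
  - by rewrite linearB/= tr_scalar_mx sA.
  - by move=> u; rewrite formB subr_ge0.
  - by rewrite formB v1 mulr1 subrr.
move=> /eqP; rewrite mulmxBr mul_mx_scalar subr_eq0 eq_sym => /eqP vA.
have ev : eigenvalue A l.
  by apply/eigenvalueP; exists v => //; rewrite -sqnorm_eq0 v1 oner_eq0.
apply: (le_trans (vmax w)); apply: ler_wpM2r; first exact: sqnorm_ge0.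
apply: ub_le_sup => //; exists l => m /= /eigenvalue_form[u u0 uE].
have upos : 0 < sqnorm u by rewrite lt_def sqnorm_eq0 u0 sqnorm_ge0.
by rewrite -(ler_pM2r upos) -uE.
Qed.

End Rayleigh.

(** * Square integrability of the Jacobi weight *)

Section Integrability.
Context {R : realType}.
Local Notation mu := (@lebesgue_measure R).

(** This lemma and the next two put linear operations under [EFin], the shape
    in which integrals of real-valued functions ask for integrability. *)
Lemma integrable_EFinZ (D : set R) (k : R) (f : R -> R) : measurable D ->
  mu.-integrable D (EFin \o f) -> mu.-integrable D (EFin \o (fun t => k * f t)).
Proof. by move=> mD; exact: (@integrableZl _ _ _ mu D mD k). Qed.

Lemma integrable_EFinD (D : set R) (f g : R -> R) : measurable D ->
  mu.-integrable D (EFin \o f) -> mu.-integrable D (EFin \o g) ->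
  mu.-integrable D (EFin \o (fun t => f t + g t)).
Proof. by move=> mD; exact: (@integrableD _ _ _ mu D mD (EFin \o f) (EFin \o g)). Qed.

Lemma integrable_EFinB (D : set R) (f g : R -> R) : measurable D ->
  mu.-integrable D (EFin \o f) -> mu.-integrable D (EFin \o g) ->
  mu.-integrable D (EFin \o (fun t => f t - g t)).
Proof. by move=> mD; exact: (@integrableB _ _ _ mu D mD (EFin \o f) (EFin \o g)). Qed.

Lemma itvoo_exhaustion :
  \bigcup_n `[- (1 - n.+2%:R^-1), 1 - n.+2%:R^-1]%classic = `](- 1), 1[%classic :> set R.
Proof.
apply/seteqP; split => [t [n _]|t] /=; rewrite !in_itv/=.
  have n0 : 0 < n.+2%:R^-1 :> R by [].
  by move: n0; move: (n.+2%:R^-1) => d d0 /andP[t1 t2]; apply/andP; split; lra.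
rewrite -ltr_norml => t1.
have d0 : 0 < 1 - `|t| by rewrite subr_gt0.
have [n nd] := ltr_add_invr t1.
exists n => //=; rewrite in_itv/= -ler_norml lerBrDr.
apply: le_trans (ltW nd); rewrite lerD2l lef_pV2 ?posrE// ler_nat//.
Qed.

Lemma measurable_powR_affine (e s : R) :
  measurable_fun [set: R] (fun t : R => (1 + e * t) `^ s).
Proof.
apply: (measurableT_comp (measurable_powR s)).
by apply: measurable_funD => //; exact: measurable_funM.
Qed.

Lemma is_derive_powR_affine (e s t : R) : 0 < 1 + e * t ->
  is_derive t 1 (fun u : R => (1 + e * u) `^ s)
    (s * (1 + e * t) `^ (s - 1) * e).
Proof.
move=> t0; have df : is_derive t 1 (fun u : R => 1 + e * u) e.
  by apply: is_derive_eq; rewrite /GRing.scale/= mulr1 add0r mul1r.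
have dp := is_derive1_powR s t0.
have H := (@is_derive1_comp _ (@powR R ^~ s) (fun u => 1 + e * u) t _ _ dp df).
exact: H.
Qed.

(** The sign [e] selects the endpoint, [e = 1] for [-1] and [e = -1] for [1], so
    that both factors of the weight are covered. On a symmetric interval the
    value does not depend on [e]. *)
Lemma integral_powR_affine (e s q : R) : `|e| = 1 -> s != -1 -> 0 < q < 1 ->
  (\int[mu]_(t in `[(- q)%R, q]) ((1 + e * t) `^ s)%:E =
   (((1 + q) `^ (s + 1) - (1 - q) `^ (s + 1)) / (s + 1))%:E)%E.
Proof.
move=> e1 s1 /andP[q0 q1].
have s10 : s + 1 != 0 by rewrite addr_eq0.
have pos t : -q <= t <= q -> 0 < 1 + e * t.
  rewrite -ler_norml => tq.
  have : `|e * t| < 1 by rewrite normrM e1 mul1r (le_lt_trans tq).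
  by rewrite ltr_norml => /andP[]; lra.
pose F (t : R) := (e * (s + 1))^-1 * (1 + e * t) `^ (s + 1).
have e0 : e != 0 by rewrite -normr_eq0 e1 oner_eq0.
have dF t : -q <= t <= q -> is_derive t 1 F ((1 + e * t) `^ s).
  move=> /pos/(is_derive_powR_affine (s + 1)) d.
  rewrite /F; apply: is_derive_eq.
  rewrite /GRing.scale/= addrK; field.
  by rewrite s10.
have cF t : -q <= t <= q -> {for t, continuous F}.
  by move=> /dF[d _]; apply: differentiable_continuous; apply/derivable1_diffP.
rewrite (@continuous_FTC2 _ (fun t : R => (1 + e * t) `^ s) F).
- rewrite -EFinB /F; congr (_%:E).
  move: e1 => /eqP; rewrite eqr_norml ler01 andbT => /orP[]/eqP ->;
    rewrite ?(mul1r, mulN1r, opprK); field; exact: s10.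
- lra.
- apply: derivable_within_continuous => t; rewrite in_itv/= => /pos t0.
  by have [] := is_derive_powR_affine s t0.
- split.
  + by move=> t; rewrite in_itv/= => /andP[t1 t2]; have [] // := dF t; rewrite !ltW.
  + by apply: cvg_at_right_filter; apply: cF; lra.
  + by apply: cvg_at_left_filter; apply: cF; lra.
- move=> t; rewrite in_itv/= => /andP[t1 t2]; rewrite derive1E.
  by apply/derive_val; apply: dF; rewrite !ltW.
Qed.

(** The integrals over the compact intervals exhausting [(-1, 1)] are bounded by
    [2^(s+1) / (s+1)] because [s + 1 > 0], and monotone convergence passes this
    bound to the limit. *)
Lemma integrable_powR_affine (e s : R) : `|e| = 1 -> -1 < s ->
  mu.-integrable `[(-1 : R), 1] (EFin \o (fun t => (1 + e * t) `^ s)).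
Proof.
move=> e1 s1.
have s10 : 0 < s + 1 by lra.
have mf := measurable_powR_affine e s.
apply/integrableP; split; first by apply/measurable_EFinP; apply: measurable_funTS.
under eq_integral do rewrite /= ger0_norm ?powR_ge0//.
rewrite integral_itv_bndoo; last by apply/measurable_EFinP; apply: measurable_funTS.
rewrite -itvoo_exhaustion.
pose F n := `[- (1 - n.+2%:R^-1), 1 - n.+2%:R^-1]%classic : set R.
have n01 n : 0 < (n.+2%:R^-1 : R) < 1.
  by rewrite invr_gt0 ltr0n/= invf_lt1 ?ltr0n// ltr1n.
have cvgF : (\int[mu]_(t in F n) ((1 + e * t) `^ s)%:E @[n --> \oo] -->
    \int[mu]_(t in \bigcup_n F n) ((1 + e * t) `^ s)%:E)%E.
  apply: ge0_nondecreasing_set_cvg_integral => //.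
  - move=> m n mn; rewrite subsetEset; apply: subset_itvScc;
      rewrite bnd_simp ?lerN2 lerD2l lerN2 lef_pV2 ?posrE ?ler_nat//.
  - by move=> n; exact: measurable_itv.
  - by move=> n; apply/measurable_EFinP; apply: measurable_funTS.
  - by move=> n t _; rewrite lee_fin powR_ge0.
apply: (@le_lt_trans _ _ (2 `^ (s + 1) / (s + 1))%:E); last exact: ltry.
rewrite -(cvg_lim _ cvgF)//.
apply: lime_le; first by apply/cvg_ex; eexists; exact: cvgF.
apply: nearW => n; have := n01 n; rewrite /F; move: (n.+2%:R^-1) => d d01.
rewrite integral_powR_affine//; [|by rewrite -addr_eq0 gt_eqF|lra].
rewrite lee_fin ler_pM2r ?invr_gt0//.
apply: (@le_trans _ _ ((1 + (1 - d)) `^ (s + 1))).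
  by rewrite gerBl powR_ge0.
by apply: ge0_ler_powR; rewrite ?nnegrE; lra.
Qed.

Lemma powR_le_1D (s u : R) : 1 <= u <= 2 -> u `^ s <= 1 + 2 `^ s.
Proof.
move=> /andP[u1 u2]; have [s0|s0] := leP 0 s.
  apply: (@le_trans _ _ (2 `^ s)); last by rewrite lerDr.
  by apply: ge0_ler_powR; rewrite ?nnegrE; lra.
apply: (@le_trans _ _ 1); last by rewrite lerDl powR_ge0.
by rewrite -(powRr0 u); apply: ler_powR => //; exact: ltW.
Qed.

Lemma jacobi_weight_sqr (a b t : R) :
  jacobi_weight a b t ^+ 2 = (1 - t) `^ (2 * a) * (1 + t) `^ (2 * b).
Proof.
by rewrite /jacobi_weight exprMn -!powR_mulrn ?powR_ge0// -!powRrM ![_ * 2]mulrC.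
Qed.

(** Of [1 - t] and [1 + t], which add up to 2, at least one lies in [[1, 2]],
    where its power is bounded; the product of the two powers is then at most a
    constant times the other one. This decouples the two singularities. *)
Lemma jacobi_weight_sqr_le (a b t : R) : -1 <= t <= 1 ->
  jacobi_weight a b t ^+ 2 <=
  (1 + 2 `^ (2 * a) + 2 `^ (2 * b)) *
  ((1 + -1 * t) `^ (2 * a) + (1 + 1 * t) `^ (2 * b)).
Proof.
move=> /andP[t1 t2]; rewrite jacobi_weight_sqr mulN1r mul1r.
have ? := powR_ge0 (1 - t) (2 * a). have ? := powR_ge0 (1 + t) (2 * b).
have ? := powR_ge0 2 (2 * a). have ? := powR_ge0 2 (2 * b).
have [t0|t0] := leP 0 t.
- have : (1 + t) `^ (2 * b) <= 1 + 2 `^ (2 * b) by apply: powR_le_1D; lra.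
  nra.
- have : (1 - t) `^ (2 * a) <= 1 + 2 `^ (2 * a) by apply: powR_le_1D; lra.
  nra.
Qed.

Lemma measurable_jacobi_weight (a b : R) :
  measurable_fun [set: R] (jacobi_weight a b).
Proof.
apply: measurable_funM.
  apply: eq_measurable_fun (measurable_powR_affine (-1) a) => t _.
  by rewrite mulN1r.
apply: eq_measurable_fun (measurable_powR_affine 1 b) => t _.
by rewrite mul1r.
Qed.

Lemma integrable_jacobi_weight_sqr (a b : R) : - (1 / 2) < a -> - (1 / 2) < b ->
  mu.-integrable `[(-1 : R), 1] (EFin \o (fun t => jacobi_weight a b t ^+ 2)).
Proof.
move=> ha hb.
set C := 1 + 2 `^ (2 * a) + 2 `^ (2 * b).
have ia : mu.-integrable `[(-1 : R), 1]
    (EFin \o (fun t => (1 + -1 * t) `^ (2 * a))).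
  by apply: integrable_powR_affine; [rewrite normrN1|lra].
have ib : mu.-integrable `[(-1 : R), 1]
    (EFin \o (fun t => (1 + 1 * t) `^ (2 * b))).
  by apply: integrable_powR_affine; [rewrite normr1|lra].
have iab : mu.-integrable `[(-1 : R), 1] (EFin \o (fun t =>
    C * ((1 + -1 * t) `^ (2 * a) + (1 + 1 * t) `^ (2 * b)))).
  by apply: integrable_EFinZ => //; exact: integrable_EFinD.
apply: (le_integrable _ _ _ iab) => //.
  apply/measurable_EFinP; apply: measurable_funTS.
  by apply: measurable_funX; exact: measurable_jacobi_weight.
move=> t /=; rewrite in_itv/= => t1.
rewrite lee_fin ger0_norm ?sqr_ge0//.
by apply: (le_trans (jacobi_weight_sqr_le a b t1)); exact: ler_norm.
Qed.

Lemma integrable_poly_weight_sqr (a b : R) (p : {poly R}) :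
  - (1 / 2) < a -> - (1 / 2) < b ->
  mu.-integrable `[(-1 : R), 1]
    (EFin \o (fun t => p.[t] * jacobi_weight a b t ^+ 2)).
Proof.
move=> ha hb.
suff : mu.-integrable `[(-1 : R), 1]
    ((EFin \o horner p) \* (EFin \o (fun t => jacobi_weight a b t ^+ 2)%R))%E by [].
apply: integrableMr => //.
- apply: measurable_funTS; apply: continuous_measurable_fun; exact: continuous_horner.
- have := compact_bounded (continuous_compact
    (continuous_subspaceT (@continuous_horner _ p)) (@segment_compact _ (-1) 1)).
  move=> [M [Mr HM]]; exists M; split => // K MK t tI; apply: HM => //.
  by exists t.
- exact: integrable_jacobi_weight_sqr.
Qed.

End Integrability.

(** * Cauchy-Schwarz on a cell and summation over the mesh *)

Section Cells.
Context {R : realType}.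
Local Notation mu := (@lebesgue_measure R).

Lemma Rintegral_itv_cst (u v k : R) : u < v ->
  \int[mu]_(t in `[u, v]) k = k * (v - u).
Proof.
by move=> uv; rewrite Rintegral_cst//= lebesgue_measure_itv/= lte_fin uv.
Qed.

Lemma integrable_itv_cst (u v k : R) :
  mu.-integrable `[u, v] (EFin \o (fun=> k)).
Proof.
apply: continuous_compact_integrable; first exact: segment_compact.
exact/continuous_subspaceT/cst_continuous.
Qed.

(** On a bounded interval [|f| <= 1 + f^2]. *)
Lemma integrable_of_sqr (u v : R) (f : R -> R) :
  measurable_fun [set: R] f ->
  mu.-integrable `[u, v] (EFin \o (fun t => f t ^+ 2)) ->
  mu.-integrable `[u, v] (EFin \o f).
Proof.
move=> mf f2.
have i1 : mu.-integrable `[u, v] (EFin \o (fun t => 1 + f t ^+ 2)).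
  by apply: integrable_EFinD => //; exact: integrable_itv_cst.
apply: (le_integrable _ _ _ i1) => //.
  by apply/measurable_EFinP; exact: measurable_funTS.
move=> t _; rewrite /= lee_fin.
have ft := sqr_ge0 (`|f t| - 1).
have fn : `|f t| ^+ 2 = f t ^+ 2 by rewrite real_normK ?num_real.
have fp := normr_ge0 (f t).
rewrite [leRHS]ger0_norm ?addr_ge0 ?sqr_ge0// -fn; nra.
Qed.

(** Expand [0 <= \int (f - m)^2] with [m] the mean value of [f] on the
    interval. *)
Lemma sqr_Rintegral_le (u v : R) (f : R -> R) : u < v ->
  mu.-integrable `[u, v] (EFin \o f) ->
  mu.-integrable `[u, v] (EFin \o (fun t => f t ^+ 2)) ->
  (\int[mu]_(t in `[u, v]) f t) ^+ 2 <=
  (v - u) * \int[mu]_(t in `[u, v]) (f t ^+ 2).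
Proof.
move=> uv if1 if2; set I := \int[mu]_(t in `[u, v]) f t.
have h0 : 0 < v - u by rewrite subr_gt0.
set m := I / (v - u).
have im := integrable_itv_cst u v (m ^+ 2).
have i2m : mu.-integrable `[u, v] (EFin \o (fun t => 2 * m * f t)).
  by apply: integrable_EFinZ.
have i3 : mu.-integrable `[u, v] (EFin \o (fun t => m ^+ 2 - 2 * m * f t)).
  by apply: integrable_EFinB.
have : 0 <= \int[mu]_(t in `[u, v]) (f t ^+ 2 + (m ^+ 2 - 2 * m * f t)).
  apply: Rintegral_ge0 => t _.
  have -> : f t ^+ 2 + (m ^+ 2 - 2 * m * f t) = (f t - m) ^+ 2 by ring.
  exact: sqr_ge0.
rewrite RintegralD// RintegralB// Rintegral_itv_cst// RintegralZl// -/I.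
have -> : m ^+ 2 * (v - u) - 2 * m * I = - (I ^+ 2 / (v - u)).
  by rewrite /m; field; rewrite gt_eqF.
by rewrite subr_ge0 ler_pdivrMr// mulrC.
Qed.

Lemma sum_Rintegral_cells (x : nat -> R) (N : nat) (f : R -> R) :
  (forall i, (i < N)%N -> x i < x i.+1) ->
  mu.-integrable `[x 0%N, x N] (EFin \o f) ->
  \sum_(i < N) \int[mu]_(t in `[x i, x i.+1]) f t
  = \int[mu]_(t in `[x 0%N, x N]) f t.
Proof.
elim: N => [_ _|N IH xlt intf].
  by rewrite big_ord0 set_itv1 Rintegral_set1.
have x0N : x 0%N <= x N.
  elim: N {IH intf} xlt => [//|N IH] xlt.
  by apply: (le_trans (IH _) (ltW (xlt _ _))) => // i iN; apply: xlt; rewrite ltnW.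
have xNS := xlt N (ltnSn N).
rewrite big_ord_recr/= IH; first last.
- apply: integrableS intf => //; apply: subset_itvl; rewrite bnd_simp; exact: ltW.
- by move=> i iN; apply: xlt; rewrite ltnW.
rewrite -(@Rintegral_itv_obnd_cbnd _ (x N)); last first.
  apply: integrableS intf => //; exact: subset_itvr.
rewrite -(@Rintegral_itvB _ _ (BLeft (x 0%N)))//; [ring | exact: ltW].
Qed.

Lemma Rintegral_sum (I : finType) (D : set R) (F : I -> R -> R) :
  measurable D -> (forall i, mu.-integrable D (EFin \o F i)) ->
  \int[mu]_(t in D) (\sum_i F i t) = \sum_i \int[mu]_(t in D) F i t.
Proof.
move=> mD iF; rewrite /Rintegral.
under eq_integral do rewrite -sumEFin.
rewrite integral_sum//= -sum_fine// => i _.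
exact: (@integrable_fin_num _ _ _ mu D mD _ (iF i)).
Qed.

End Cells.

(** * The histopolation matrix and the Gram form *)

Section HistopolationBound.
Context {R : realType} (a b : R) (ha : - (1 / 2) < a) (hb : - (1 / 2) < b).
Context (P : nat -> {poly R}) (N : nat).
Local Notation mu := (@lebesgue_measure R).
Local Notation w := (jacobi_weight a b).

Definition weighted_comb (c : 'cV[R]_N) (t : R) : R :=
  (\sum_(j < N) c j 0 *: P j).[t] * w t.

Lemma measurable_weighted_poly (p : {poly R}) :
  measurable_fun [set: R] (fun t => p.[t] * w t).
Proof.
apply: measurable_funM; last exact: measurable_jacobi_weight.
by apply: continuous_measurable_fun; exact: continuous_horner.
Qed.

Lemma integrable_weighted_poly_sqr (p : {poly R}) :
  mu.-integrable `[(-1 : R), 1] (EFin \o (fun t => (p.[t] * w t) ^+ 2)).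
Proof.
have -> : (fun t => (p.[t] * w t) ^+ 2) = (fun t => (p ^+ 2).[t] * w t ^+ 2).
  by apply/funext => t; rewrite horner_exp exprMn.
exact: integrable_poly_weight_sqr.
Qed.

Lemma integrable_weighted_poly (p : {poly R}) :
  mu.-integrable `[(-1 : R), 1] (EFin \o (fun t => p.[t] * w t)).
Proof.
exact: integrable_of_sqr (measurable_weighted_poly p)
  (integrable_weighted_poly_sqr p).
Qed.

Lemma weighted_combE c t :
  weighted_comb c t = \sum_(j < N) c j 0 * ((P j).[t] * w t).
Proof.
rewrite /weighted_comb horner_sum mulr_suml; apply: eq_bigr => j _.
by rewrite hornerZ -mulrA.
Qed.

Lemma histopolation_mxE (x : nat -> R) c (i : 'I_N) :
  `[x i, x i.+1] `<=` `[(-1 : R), 1] ->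
  (histopolation_mx a b P x N *m c) i 0 =
  (cell_length x i)^-1 * \int[mu]_(t in `[x i, x i.+1]) weighted_comb c t.
Proof.
move=> sub.
have ip j : mu.-integrable `[x i, x i.+1] (EFin \o (fun t => (P j).[t] * w t)).
  by apply: integrableS (integrable_weighted_poly (P j)).
under eq_Rintegral do rewrite weighted_combE.
rewrite Rintegral_sum//; last first.
  by move=> j; apply: integrable_EFinZ => //; exact: ip.
rewrite mxE mulr_sumr; apply: eq_bigr => j _.
by rewrite RintegralZl// mxE; ring.
Qed.

(** Expanding the square of [p w] as a double sum exchanges the integral with the
    summation, term by term against the entries of the Gram matrix. *)
Lemma mxform_gram c :
  mxform (gram_mx a b P N) c^T c^T =
  \int[mu]_(t in `[(-1 : R), 1]) (weighted_comb c t ^+ 2).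
Proof.
have ip (j k : nat) : mu.-integrable `[(-1 : R), 1]
    (EFin \o (fun t => (P j).[t] * (P k).[t] * w t ^+ 2)).
  have -> : (fun t => (P j).[t] * (P k).[t] * w t ^+ 2)
      = (fun t => (P j * P k).[t] * w t ^+ 2).
    by apply/funext => t; rewrite hornerM.
  exact: integrable_poly_weight_sqr.
have ic (j k : 'I_N) : mu.-integrable `[(-1 : R), 1] (EFin \o (fun t =>
    (c j 0 * c k 0) * ((P j).[t] * (P k).[t] * w t ^+ 2))).
  by apply: integrable_EFinZ.
have sqE t : weighted_comb c t ^+ 2 =
    \sum_(jk : 'I_N * 'I_N)
      (c jk.1 0 * c jk.2 0) * ((P jk.1).[t] * (P jk.2).[t] * w t ^+ 2).
  rewrite expr2 !weighted_combE big_distrlr/= pair_big/=.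
  by apply: eq_bigr => jk _; ring.
under eq_Rintegral do rewrite sqE.
rewrite Rintegral_sum//.
rewrite mxformE pair_big/=; apply: eq_bigr => -[j k] _ /=.
by rewrite RintegralZl// !mxE.
Qed.

Lemma gram_mx_sym : (gram_mx a b P N)^T = gram_mx a b P N.
Proof.
apply/matrixP => j k; rewrite !mxE; apply: eq_Rintegral => t _.
by rewrite [_.[t] * _]mulrC.
Qed.

(** Cell by cell, [h_i] times the squared mean of [p w] is at most the integral
    of its square; the cells tile [[-1, 1]]. *)
Lemma mesh_sqr_le_gram (x : nat -> R) (c : 'cV[R]_N) :
  x 0%N = -1 -> x N = 1 -> (forall i, (i < N)%N -> x i < x i.+1) ->
  \sum_(i < N) cell_length x i * `|(histopolation_mx a b P x N *m c) i 0| ^+ 2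
  <= mxform (gram_mx a b P N) c^T c^T.
Proof.
move=> x0 xN xlt.
have xmono i j : (i <= j)%N -> (j <= N)%N -> x i <= x j.
  elim: j => [|j IH]; first by rewrite leqn0 => /eqP ->.
  rewrite leq_eqVlt => /predU1P[-> //|]; rewrite ltnS => ij jN.
  exact: le_trans (IH ij (ltnW jN)) (ltW (xlt _ jN)).
have sub (i : 'I_N) : `[x i, x i.+1] `<=` `[(-1 : R), 1].
  by apply: subset_itvScc; rewrite bnd_simp -?x0 -?xN xmono// ltnW.
rewrite mxform_gram -x0 -xN -sum_Rintegral_cells//; last first.
  by rewrite x0 xN; exact: integrable_weighted_poly_sqr.
apply: ler_sum => i _.
have h0 : 0 < cell_length x i by rewrite subr_gt0 xlt.
have i2 : mu.-integrable `[x i, x i.+1]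
    (EFin \o (fun t => weighted_comb c t ^+ 2)).
  exact: integrableS (integrable_weighted_poly_sqr _).
have i1 := integrable_of_sqr (measurable_weighted_poly _) i2.
rewrite histopolation_mxE// real_normK ?num_real// exprMn.
set J := \int[mu]_(t in _) weighted_comb c t.
have -> : cell_length x i * ((cell_length x i)^-1 ^+ 2 * J ^+ 2) =
    J ^+ 2 / cell_length x i by field; rewrite gt_eqF.
rewrite ler_pdivrMr// mulrC.
by apply: sqr_Rintegral_le => //; exact: xlt.
Qed.

End HistopolationBound.

Theorem theorem4p15 (R : realType) (a b : R)
    (ha : - (1 / 2) < a) (hb : - (1 / 2) < b)
    (P : nat -> {poly R}) (hP : jacobi_polynomials a b P)
    (N : nat) (hN : (1 <= N)%N)
    (x : nat -> R) (hx0 : x 0%N = -1) (hxN : x N = 1)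
    (hx : forall i : nat, (i < N)%N -> x i < x i.+1)
    (c : 'cV[R]_N) :
  mesh_norm x (histopolation_mx a b P x N *m c) ^+ 2
    <= norm2 c ^+ 2 * lambda_max (gram_mx a b P N)
  /\
  mesh_norm x (histopolation_mx a b P x N *m c)
    <= norm2 c * Num.sqrt (lambda_max (gram_mx a b P N)).
Proof.
set H := histopolation_mx a b P x N; set G := gram_mx a b P N.
have norm2E : norm2 c ^+ 2 = sqnorm c^T.
  rewrite /norm2 sqr_sqrtr; last by apply: sumr_ge0 => i _; exact: sqr_ge0.
  by apply: eq_bigr => i _; rewrite mxE real_normK ?num_real.
have meshE : mesh_norm x (H *m c) ^+ 2 =
    \sum_(i < N) cell_length x i * `|(H *m c) i 0| ^+ 2.
  rewrite sqr_sqrtr//; apply: sumr_ge0 => i _.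
  by rewrite mulr_ge0 ?sqr_ge0// subr_ge0 ltW// hx.
have sq_le : mesh_norm x (H *m c) ^+ 2 <= norm2 c ^+ 2 * lambda_max G.
  rewrite meshE norm2E mulrC.
  apply: (le_trans (mesh_sqr_le_gram ha hb P c hx0 hxN hx)).
  exact: (rayleigh_le_lambda_max hN (gram_mx_sym a b P N)).
split => //.
rewrite -[mesh_norm _ _]ger0_norm ?sqrtr_ge0// -[norm2 c]ger0_norm ?sqrtr_ge0//.
by rewrite -!sqrtr_sqr -sqrtrM ?sqr_ge0//; exact: ler_wsqrtr.
Qed.
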